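(* Let $p\in\mathbb N$ and for $j=1,\dots,p$ let $w_j(x)=\sum_{i=0}^\infty\lambda_{i,j,1}x^i$, $x\in\Delta_0=[-1,1]$, be real power series. The series $w_1,\dots,w_p$ converge uniformly on $\Delta_0$ to an M-Nikishin system of functions $(\widetilde s_1,\dots,\widetilde s_p)$ if and only if for each $k=1,\dots,p-1$ there exists a system of sequences $(C_{k,k},\dots,C_{p,k})$ (constructed as in the context) such that the restricted Hausdorff moment problems of all these sequences have solutions.
   Context: $\Delta_0=[-1,1]$, $\Delta_1=[0,1]$. $\mathcal M(\Delta_1)$: finite Borel measures on $\Delta_1$ with infinitely many points in the support and not changing sign. $\mathcal M_0(\Delta_1)$: those $\sigma\in\mathcal M(\Delta_1)$ with $\lim_{x\to1,\,x\in(0,1)}\left|\int_{\Delta_1}\frac{d\sigma(t)}{1-tx}\right|<+\infty$. For $\sigma\in\mathcal M_0(\Delta_1)$ put $\widetilde\sigma(x)=\int_{\Delta_1}\frac{d\sigma(t)}{1-tx}$. For $\sigma_\alpha,\sigma_\beta\in\mathcal M_0(\Delta_1)$ define the measure $[\sigma_\alpha,\sigma_\beta]$ by $d[\sigma_\alpha,\sigma_\beta](x)=\widetilde\sigma_\beta(x)\,d\sigma_\alpha(x)$, and recursively $[\sigma_1,\sigma_2,\dots,\sigma_k]=[\sigma_1,[\sigma_2,\dots,\sigma_k]]$. Given $\sigma_1,\dots,\sigma_p\in\mathcal M_0(\Delta_1)$, the M-Nikishin system of measures is $(s_1,\dots,s_p)$ with $s_1=\sigma_1$, $s_k=[\sigma_1,\dots,\sigma_k]$,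 and the corresponding M-Nikishin system of functions is $(\widetilde s_1,\dots,\widetilde s_p)$. The restricted Hausdorff moment problem for a real sequence $\{c_i\}_{i\ge0}$ asks for $\sigma\in\mathcal M_0(\Delta_1)$ with $c_i=\int t^i d\sigma(t)$ for all $i\ge0$. Construction of the sequences: put $\theta_{j,1}=(\lambda_{0,j,1},\lambda_{1,j,1},\dots)^\top$ for $j=1,\dots,p$ and let $\Theta_1=(\lambda_{i+m,1,1})_{i,m\ge0}$ (semi-infinite Hankel matrix). Recursively, given $\Theta_k=(\lambda_{i+m,k,k})_{i,m\ge0}$ and vectors $\theta_{j,k}$, $j=k,\dots,p$, look for vectors $\theta_{j,k+1}=(\lambda_{0,j,k+1},\lambda_{1,j,k+1},\dots)^\top$, $j=k+1,\dots,p$, solving $\Theta_k\theta_{j,k+1}=\theta_{j,k}$, meaning $\sum_{i=0}^\infty\lambda_{l+i,k,k}\lambda_{i,j,k+1}=\lambda_{l,j,k}$ for all $l\in\mathbb Z_+$; if such solutions exist set $\Theta_{k+1}=(\lambda_{i+m,k+1,k+1})_{i,m\ge0}$. The sequences are $C_{j,k}=\{\lambda_{i,j,k}\}_{i=0}^\infty$, $j=k,\dots,p$. If the linear systems at some step have no solution, the system $(C_{k,k},\dots,C_{p,k})$ is said not to exist.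
   Formalization: The systems (C_{k,k},...,C_{p,k}) with solvable moment problems are required for k=1,...,p rather than k=1,...,p-1, as one chain of solutions; with p-1 the claim fails (p=1, w_1=0 makes the condition vacuous). *)

(* Defs.v *)
From HB Require Import structures.
From mathcomp Require Import all_boot all_order all_algebra.
From mathcomp Require Import all_classical all_reals all_analysis.
Set Implicit Arguments. Unset Strict Implicit. Unset Printing Implicit Defensive.
Import Order.TTheory GRing.Theory Num.Theory.
Import numFieldNormedType.Exports.
Local Open Scope classical_set_scope.
Local Open Scope ring_scope.

Section MNikishin.
Variable R : realType.

(* A measure on Delta_1 = [0,1] not changing sign is represented as
   sigma = sgn b * mu with mu a (nonnegative) Borel measure on R carried by [0,1]. *)
Definition sgn (b : bool) : R := if b then 1 else -1.

Definition supp (mu : {measure set R -> \bar R}) : set R :=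
  [set x | forall e : R, 0 < e -> (0 < mu (ball x e))%E].

Definition in_M (mu : {measure set R -> \bar R}) : Prop :=
  [/\ (mu setT < +oo)%E, mu (~` `[0, 1]) = 0%E & ~ finite_set (supp mu)].

Definition sint (b : bool) (mu : {measure set R -> \bar R}) (f : R -> R) : R :=
  sgn b * Rintegral mu `[0, 1] f.

Definition tilde (b : bool) (mu : {measure set R -> \bar R}) (x : R) : R :=
  sint b mu (fun t => (1 - t * x)^-1).

Definition in_M0 (b : bool) (mu : {measure set R -> \bar R}) : Prop :=
  in_M mu /\ exists L : R, (fun x => `|tilde b mu x|) x @[x --> 1^'-] --> L.

(* nik b mu n m = Cauchy transform of [sigma_m, sigma_(m+1), ..., sigma_(m+n)],
   unfolding d[sigma_a, tau](t) = tilde tau (t) d sigma_a (t). *)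
Fixpoint nik (b : nat -> bool) (mu : nat -> {measure set R -> \bar R})
    (n m : nat) (x : R) : R :=
  match n with
  | 0 => tilde (b m) (mu m) x
  | n'.+1 => sint (b m) (mu m) (fun t => nik b mu n' m.+1 t * (1 - t * x)^-1)
  end.

Definition nikishin_fun (b : nat -> bool) (mu : nat -> {measure set R -> \bar R})
    (k : nat) : R -> R := nik b mu k.-1 1.

Definition moment (b : bool) (mu : {measure set R -> \bar R}) (i : nat) : R :=
  sint b mu (fun t => t ^+ i).

Definition restricted_hausdorff_solvable (c : nat -> R) : Prop :=
  exists (b : bool) (mu : {measure set R -> \bar R}),
    in_M0 b mu /\ forall i, c i = moment b mu i.

Definition unif_cvg_on (A : set R) (u : nat -> R -> R) (f : R -> R) : Prop :=
  forall e : R, 0 < e -> exists N : nat, forall n, (N <= n)%N ->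
    forall x, A x -> `|u n x - f x| < e.

End MNikishin.

(* Main.v *)
Require Import Defs.
From HB Require Import structures.
From mathcomp Require Import all_boot all_order all_algebra.
From mathcomp Require Import all_classical all_reals all_analysis.
From mathcomp Require Import measurable_realfun ring lra zify.
Import Order.TTheory GRing.Theory Num.Theory.
Import numFieldNormedType.Exports.
Local Open Scope classical_set_scope.
Local Open Scope ring_scope.

(** Expanding 1 / (1 - t x) into a geometric series shows that the Cauchy
    transform of a measure in M_0 is the sum of the power series of its moments,
    with a remainder at most the integral of t^n / (1 - t), uniformly on [-1,1];
    this tends to 0 because 1 / (1 - t) is integrable.  Integrating the series
    of the transform of [sigma_(k+1), ..., sigma_j] against t^l d sigma_k says
    exactly that the moments of all the brackets solve the linear systems.
    Conversely the solutions of the linear systems are sums of series, hence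
    unique, so descending from the diagonal C_(j,j) every C_(j,k) is forced to
    be the moment sequence of [sigma_k, ..., sigma_j], where sigma_k solves the
    moment problem of C_(k,k).  The transform of a measure in M_0 has constant
    sign and lies between two positive constants in absolute value on [0,1], so
    brackets stay in M_0. *)

(** * Measures given by a nonnegative density *)

Section density.
Set Implicit Arguments. Unset Strict Implicit. Unset Printing Implicit Defensive.
Local Open Scope ereal_scope.
Context d (T : measurableType d) (R : realType).
Variables (mu : {measure set T -> \bar R}) (h : T -> R).
Hypotheses (mh : measurable_fun setT h) (h0 : forall t, (0 <= h t)%R).

(** The two proofs are arguments so that the measure structure declared below, whose axioms rest on
    them, can be inferred from the term [density mh h0]. *)
Definition density of measurable_fun setT h & (forall t, (0 <= h t)%R) :=
  fun A : set T => \int[mu]_(t in A) (h t)%:E.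

Local Notation rho := (density mh h0).

Let mhE A : measurable_fun A (EFin \o h).
Proof. by apply/measurable_EFinP; exact: measurable_funS mh. Qed.

Let rho0 : rho set0 = 0. Proof. exact: integral_set0. Qed.

Let rho_ge0 A : 0 <= rho A.
Proof. by apply: integral_ge0 => t _; rewrite lee_fin. Qed.

Let rho_sigma_additive : semi_sigma_additive rho.
Proof.
move=> F mF tF mUF; apply: cvg_toP; first exact: is_cvg_nneseries.
rewrite /density ge0_integral_bigcup//.
by move=> t _; rewrite lee_fin.
Qed.

HB.instance Definition _ := isMeasure.Build _ _ _ rho rho0 rho_ge0 rho_sigma_additive.

Import HBNNSimple.

Let integral_density_nnsfun (g : {nnsfun T >-> R}) :
  \int[rho]_t (g t)%:E = \int[mu]_t ((g t)%:E * (h t)%:E).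
Proof.
rewrite integralT_nnsfun sintegralE.
under [RHS]eq_integral => t _.
  rewrite (fimfunE g) -fsumEFin// ge0_mule_fsuml; last by move=> y; rewrite EFinM; exact: nnfun_muleindic_ge0.
  over.
rewrite ge0_integral_fsum//; last 2 first.
- move=> y; apply: emeasurable_funM; last exact: mhE.
  by apply/measurable_EFinP; exact: measurable_funM.
- by move=> y t _; rewrite mule_ge0 ?EFinM ?nnfun_muleindic_ge0 ?lee_fin.
apply: eq_fsbigr => y /set_mem [s _ <-].
under [RHS]eq_integral => t _ do rewrite EFinM -muleA.
rewrite ge0_integralZl_EFin//; last 2 first.
- by move=> t _; rewrite mule_ge0 ?lee_fin.
- apply: emeasurable_funM; last exact: mhE.
  by apply/measurable_EFinP.
congr (_ * _); rewrite /= /density integral_mkcond; apply: eq_integral => t _.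
by rewrite epatch_indic muleC.
Qed.

(** After extension by 0 outside [D], [f] is the increasing limit of simple functions [g n]. The
    identity holds for each [g n] by additivity over its fibres, and monotone convergence for [rho]
    and for [mu] carries it to the limit. *)
Lemma ge0_integral_density (D : set T) (f : T -> \bar R) : measurable D ->
  measurable_fun D f -> (forall t, D t -> 0 <= f t) ->
  \int[rho]_(t in D) f t = \int[mu]_(t in D) (f t * (h t)%:E).
Proof.
move=> mD mf f0; rewrite [LHS]integral_mkcond [RHS]integral_mkcond.
have {}mf : measurable_fun setT (f \_ D) by apply/(measurable_restrictT f).
have {}f0 t : 0 <= (f \_ D) t by exact: erestrict_ge0.
rewrite [RHS](eq_integral (fun t => (f \_ D) t * (h t)%:E)); last first.
  by move=> t _; rewrite !patchE; case: ifPn => //; rewrite mul0e.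
pose g := nnsfun_approx measurableT mf.
have gf t : (g n t)%:E @[n --> \oo] --> (f \_ D) t.
  exact: cvg_nnsfun_approx.
have ndg t n m : (n <= m)%N -> (g n t <= g m t)%R.
  by move=> nm; exact/lefP/nd_nnsfun_approx.
transitivity (limn (fun n => \int[rho]_t (g n t)%:E)).
  rewrite -monotone_convergence//; last 3 first.
  - by move=> n; apply/measurable_EFinP.
  - by move=> n t _; rewrite lee_fin.
  - by move=> t _ n m nm; rewrite lee_fin ndg.
  by apply: eq_integral => t _; apply/esym/cvg_lim.
under eq_fun do rewrite integral_density_nnsfun.
rewrite -monotone_convergence//; last 3 first.
- by move=> n; apply: emeasurable_funM; [exact/measurable_EFinP|exact: mhE].
- by move=> n t _; rewrite mule_ge0 ?lee_fin.
- by move=> t _ n m nm; rewrite lee_wpmul2r ?lee_fin ?ndg.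
by apply: eq_integral => t _; apply/cvg_lim => //; exact: cvgeZr.
Qed.

End density.

(** * Uniqueness of the coefficients of a power series *)

Section power_series.
Set Implicit Arguments. Unset Strict Implicit. Unset Printing Implicit Defensive.
Context {R : realType}.
Implicit Types x : R.

Lemma cvg_of_norm_sub_le (f u : R ^nat) (l : R) :
  (forall n, `|f n - l| <= u n) -> u n @[n --> \oo] --> 0 -> f n @[n --> \oo] --> l.
Proof.
move=> fu u0; apply/subr_cvg0; apply: norm_cvg0.
apply: (@squeeze_cvgr _ _ _ _ (cst 0) u _ _ 0 (cvg_cst 0) u0).
by apply: nearW => n; rewrite normr_ge0 fu.
Qed.

Lemma unif_cvg_on_cvg (A : set R) (u : nat -> R -> R) (f : R -> R) x :
  unif_cvg_on A u f -> A x -> u n x @[n --> \oo] --> f x.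
Proof.
move=> uf Ax; apply/cvgrPdist_lt => e /uf[N uN].
by exists N => // n Nn; rewrite /= distrC uN.
Qed.

(** Convergence at 1 bounds all coefficients by some [M]. If [d n] were the first nonzero one, then
    at a small x > 0 the tail beyond n, at most [M] times a geometric series, would be too small to
    cancel the term of index n. *)
Lemma power_series_eq0 (d : nat -> R) :
  (forall x, 0 <= x <= 1 -> \sum_(0 <= i < n) d i * x ^+ i @[n --> \oo] --> (0 : R)) ->
  forall n, d n = 0.
Proof.
move=> d0.
have [M Mgt0 dM] : exists2 M : R, 0 < M & forall n, `|d n| <= M.
  have d1 : series d n @[n --> \oo] --> (0 : R).
    have := d0 1; rewrite ler01 lexx => /(_ isT).
    by under eq_fun do under eq_bigr do rewrite expr1n mulr1.
  have /cvgP/cvg_seq_bounded[M [_ Md]] := cvg_series_cvg_0 (cvgP _ d1).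
  exists (`|M| + 1); first by rewrite ltr_wpDl.
  by move=> n; apply: Md => //; rewrite ltr_pwDr// ler_norm.
have geom n k x : 0 <= x < 1 -> \sum_(n <= i < n + k) x ^+ i <= x ^+ n / (1 - x).
  move=> /andP[x0 x1]; have x1' : 0 < 1 - x by rewrite subr_gt0.
  rewrite ler_pdivlMr//.
  have -> : (\sum_(n <= i < n + k) x ^+ i) * (1 - x) = x ^+ n - x ^+ (n + k).
    elim: k => [|k IHk]; first by rewrite addn0 big_geq// mul0r subrr.
    by rewrite addnS big_nat_recr ?leq_addr//= mulrDl IHk exprS; ring.
  by rewrite gerBl exprn_ge0.
move=> n; elim/ltn_ind: n => n dlt.
apply/eqP/contraT => dn0; have dn : 0 < `|d n| by rewrite normr_gt0.
(* Dividing the bound below by x^n gives |d n| <= M x / (1 - x), which is at most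
   |d n| / 3 for this x. *)
pose x := `|d n| / (4 * M).
have x0 : 0 < x by rewrite divr_gt0// mulr_gt0.
have x14 : x <= 4^-1 by rewrite ler_pdivrMr ?mulr_gt0// mulrA mulVf// mul1r.
have bound : `|d n| * x ^+ n <= M * (x ^+ n.+1 / (1 - x)).
  have x01 : 0 <= x <= 1 by apply/andP; split; lra.
  pose K := M * (x ^+ n.+1 / (1 - x)).
  (* For N > n the partial sum is [d n * x ^+ n + s] with [s] at most [K] in absolute value, so
     [|d n| * x ^+ n] is at most this sequence; its limit is [K]. *)
  have lim : `|\sum_(0 <= i < N) d i * x ^+ i| + K @[N --> \oo] --> K.
    rewrite -[X in _ --> X]add0r; apply: cvgD; last exact: cvg_cst.
    by rewrite -[X in _ --> X](normr0 R); apply: cvg_norm; exact: d0.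
  apply: (ler_cvg_to (cvg_cst _) lim); exists n.+1 => // N /= nN.
  rewrite (@big_cat_nat _ _ _ n.+1)//= big_nat_recr//=.
  rewrite big_nat_cond big1 => [|i]; last by rewrite andbT => /andP[_ /dlt ->]; rewrite mul0r.
  rewrite add0r; set s := (X in `|_ + X|).
  have sle : `|s| <= M * (x ^+ n.+1 / (1 - x)).
    rewrite (le_trans (ler_norm_sum _ _ _))//.
    have geomN : \sum_(n.+1 <= i < N) x ^+ i <= x ^+ n.+1 / (1 - x).
      by rewrite -(subnKC nN); apply: geom; apply/andP; split; lra.
    rewrite (le_trans _ (ler_wpM2l (ltW Mgt0) geomN))//.
    rewrite mulr_sumr; apply: ler_sum => i _.
    by rewrite normrM normrX (gtr0_norm x0) ler_wpM2r// exprn_ge0// ltW.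
  have -> : `|d n| * x ^+ n = `|d n * x ^+ n| by rewrite normrM normrX (gtr0_norm x0).
  have := ler_normB (d n * x ^+ n + s) s; rewrite addrK => /le_trans; apply.
  by rewrite lerD2l.
have Mx : M * x = `|d n| / 4 by rewrite /x; field; rewrite gt_eqF.
have xn : 0 < x ^+ n by rewrite exprn_gt0.
have x1 : 0 < 1 - x by lra.
move: bound; rewrite exprS mulrA mulrA Mx ler_pdivlMr//.
have -> : `|d n| / 4 * x ^+ n = (`|d n| * x ^+ n) / 4 by ring.
have : 0 < `|d n| * x ^+ n by rewrite mulr_gt0.
by set y := _ * _; nra.
Qed.

Lemma power_series_inj (a c : nat -> R) (f : R -> R) :
  unif_cvg_on `[-1, 1] (fun n x => \sum_(0 <= i < n) a i * x ^+ i) f ->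
  unif_cvg_on `[-1, 1] (fun n x => \sum_(0 <= i < n) c i * x ^+ i) f ->
  forall i, a i = c i.
Proof.
move=> af cf i; apply/eqP; rewrite -subr_eq0; apply/eqP; move: i.
apply: power_series_eq0 => x /andP[x0 x1].
have x01 : `[-1, 1]%classic x by rewrite /= in_itv/=; apply/andP; split; lra.
have -> : (fun n => \sum_(0 <= i < n) (a i - c i) * x ^+ i) =
    (fun n => \sum_(0 <= i < n) a i * x ^+ i - \sum_(0 <= i < n) c i * x ^+ i).
  by apply/funext => n; rewrite -sumrB; apply: eq_bigr => i _; rewrite mulrBl.
rewrite -[X in _ --> X](subrr (f x)).
by apply: cvgB; [exact: unif_cvg_on_cvg af x01|exact: unif_cvg_on_cvg cf x01].
Qed.

End power_series.

(** * Cauchy kernels and integrals over [0,1[ *)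

Section cauchy_transform.
Set Implicit Arguments. Unset Strict Implicit. Unset Printing Implicit Defensive.
Context {R : realType}.
Implicit Types (mu nu : {measure set R -> \bar R}) (b : bool) (t x : R).

Local Notation I := (`[0, 1[%classic : set R).

Lemma normr_sgn b : `|sgn R b| = 1.
Proof. by case: b; rewrite /= ?normrN normr1. Qed.

Lemma sgn_mulss b : sgn R b * sgn R b = 1.
Proof. by case: b; rewrite /= ?mulrNN mulr1. Qed.

Lemma in_I t : I t -> 0 <= t < 1.
Proof. by rewrite /= in_itv. Qed.

Lemma measurable_I : measurable I.
Proof. exact: measurable_itv. Qed.

Lemma cauchy_kernel_denom t x : 0 <= t < 1 -> -1 <= x <= 1 -> 1 - t <= 1 - t * x.
Proof. by move=> /andP[t0 t1] /andP[x0 x1]; nra. Qed.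

Lemma cauchy_kernel_denom_gt0 t x : 0 <= t < 1 -> -1 <= x <= 1 -> 0 < 1 - t * x.
Proof.
move=> t01 x01; apply: lt_le_trans _ (cauchy_kernel_denom t01 x01).
by case/andP: t01 => _ t1; rewrite subr_gt0.
Qed.

Lemma cauchy_kernel_le t x : 0 <= t < 1 -> -1 <= x <= 1 ->
  (1 - t * x)^-1 <= (1 - t)^-1.
Proof.
move=> t01 x01; rewrite lef_pV2 ?posrE ?cauchy_kernel_denom_gt0 ?cauchy_kernel_denom//.
by case/andP: t01 => _ t1; rewrite subr_gt0.
Qed.

Lemma cauchy_kernel1_ge1 t : 0 <= t < 1 -> 1 <= (1 - t)^-1.
Proof. by move=> /andP[t0 t1]; rewrite invf_ge1 ?subr_gt0// gerBl. Qed.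

Lemma cauchy_kernel_le_nondecreasing t x y : 0 <= t < 1 -> -1 <= x <= 1 ->
  -1 <= y <= 1 -> x <= y -> (1 - t * x)^-1 <= (1 - t * y)^-1.
Proof.
move=> t01 x01 y01 xy.
rewrite lef_pV2 ?posrE ?cauchy_kernel_denom_gt0// lerD2l lerN2.
by case/andP: t01 => t0 _; rewrite ler_wpM2l.
Qed.

Lemma measurable_cauchy_kernel x : -1 <= x <= 1 ->
  measurable_fun I (fun t => (1 - t * x)^-1).
Proof.
move=> x01; apply: subspace_continuous_measurable_fun; first exact: measurable_I.
apply: continuous_in_subspaceT => t /set_mem /in_I t01.
apply: cvgV; first by rewrite gt_eqF// cauchy_kernel_denom_gt0.
by apply: cvgB; [exact: cvg_cst|apply: cvgM; [exact: cvg_id|exact: cvg_cst]].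
Qed.

Lemma measurable_cauchy_kernel1 : measurable_fun I (fun t => (1 - t)^-1).
Proof.
rewrite (_ : (fun t => _) = (fun t => (1 - t * 1)^-1)); last first.
  by apply/funext => t; rewrite mulr1.
by apply: measurable_cauchy_kernel; apply/andP; split; lra.
Qed.

Lemma measurable_pow n : measurable_fun I (fun t => t ^+ n).
Proof. by apply: measurable_funX; exact: measurable_id. Qed.

Lemma setDitv01 : (`[0, 1] `\` [set 1])%classic = I.
Proof.
apply/seteqP; split => t /=; rewrite !in_itv/=.
  by move=> [/andP[-> t1] /eqP nt]; rewrite lt_neqAle nt.
by move=> /andP[t0 t1]; split; [rewrite t0 ltW|apply/eqP; rewrite lt_eqF].
Qed.

Lemma setU_I1 : I `|` [set 1] = (`[0, 1]%classic : set R).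
Proof. by rewrite -setDitv01 setDKU// => ? /= ->; rewrite in_itv/= ler01 lexx. Qed.

Lemma measurable_fun_itv01 (f : R -> R) :
  measurable_fun I f -> measurable_fun (`[0, 1]%classic : set R) f.
Proof.
move=> mf; rewrite -setU_I1; apply/measurable_funU => //; split => //.
exact: measurable_fun_set1.
Qed.

(** The null point 1 is removed from the positive and the negative part separately, each being a
    nonnegative integral. *)
Lemma sint_I b mu (f : R -> R) : mu [set 1] = 0%E -> measurable_fun I f ->
  sint b mu f = sgn R b * \int[mu]_(t in I) f t.
Proof.
move=> mu1 mf; congr (_ * fine _).
have mfE : measurable_fun (`[0, 1]%classic : set R) (EFin \o f).
  by apply/measurable_EFinP; exact: measurable_fun_itv01.
rewrite integralE [in RHS]integralE -setDitv01; congr (_ - _)%E.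
  by apply: ge0_negligible_integral => //; exact: measurable_funepos.
by apply: ge0_negligible_integral => //; exact: measurable_funeneg.
Qed.

(* Equivalent to the existence of the limit in in_M0. Since (1 - 1)^-1 = 0 here,
   integrability alone would not exclude an atom at 1. *)
Definition cauchy_integrable mu : Prop :=
  mu [set 1] = 0%E /\ mu.-integrable I (fun t => ((1 - t)^-1)%:E).

(** * Moments and transform of a single measure *)

Section one_measure.
Variables (b : bool) (mu : {measure set R -> \bar R}).
Hypothesis cmu : cauchy_integrable mu.

(** Source of most integrability facts below. It also covers bounded functions, because 1 / (1 - t)
    is at least 1 on [0,1[. *)
Lemma cauchy_dominated_integrable (C : R) (f : R -> R) : measurable_fun I f ->
  (forall t, 0 <= t < 1 -> `|f t| <= C * (1 - t)^-1) ->
  mu.-integrable I (EFin \o f).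
Proof.
move=> mf fC; have iC := integrableZl measurable_I C cmu.2.
apply: le_integrable iC => //; first exact/measurable_EFinP.
move=> t /in_I t01; rewrite -EFinM !abse_EFin lee_fin.
by rewrite (le_trans (fC _ t01))// ler_norm.
Qed.

Lemma bounded_integrable (C : R) (f : R -> R) : measurable_fun I f ->
  (forall t, 0 <= t < 1 -> `|f t| <= C) -> mu.-integrable I (EFin \o f).
Proof.
move=> mf fC; apply: (@cauchy_dominated_integrable C) => // t t01.
rewrite (le_trans (fC _ t01))// ler_peMr ?cauchy_kernel1_ge1//.
exact: le_trans (fC _ t01).
Qed.

Lemma pow_integrable n : mu.-integrable I (EFin \o (fun t => t ^+ n)).
Proof.
apply: (@bounded_integrable 1); first exact: measurable_pow.
by move=> t /andP[t0 t1]; rewrite normrX exprn_ile1// ger0_norm// ltW.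
Qed.

Lemma kernel_integrable x : -1 <= x <= 1 ->
  mu.-integrable I (EFin \o (fun t => (1 - t * x)^-1)).
Proof.
move=> x01; apply: (@cauchy_dominated_integrable 1); first exact: measurable_cauchy_kernel.
move=> t t01; rewrite mul1r ger0_norm ?cauchy_kernel_le//.
by rewrite invr_ge0 ltW// cauchy_kernel_denom_gt0.
Qed.

Lemma tilde_I x : -1 <= x <= 1 ->
  tilde b mu x = sgn R b * \int[mu]_(t in I) (1 - t * x)^-1.
Proof.
by move=> x01; rewrite /tilde sint_I; [|exact: cmu.1|exact: measurable_cauchy_kernel].
Qed.

Lemma measurable_poly_sum (l n : nat) (c : nat -> R) :
  measurable_fun I (fun t => t ^+ l * \sum_(0 <= i < n) c i * t ^+ i).
Proof.
apply: measurable_funM; first exact: measurable_pow.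
apply: measurable_sum => i; apply: measurable_funM => //; exact: measurable_pow.
Qed.

Lemma moment_I i : moment b mu i = sgn R b * \int[mu]_(t in I) t ^+ i.
Proof. by rewrite /moment sint_I; [|exact: cmu.1|exact: measurable_pow]. Qed.

Lemma poly_sum_integrable (l n : nat) (c : nat -> R) :
  mu.-integrable I (EFin \o (fun t => t ^+ l * \sum_(0 <= i < n) c i * t ^+ i)).
Proof.
apply: (@bounded_integrable (\sum_(0 <= i < n) `|c i|)); first exact: measurable_poly_sum.
move=> t /andP[t0 t1].
have tn k : `|t ^+ k| <= 1 by rewrite normrX exprn_ile1// ger0_norm// ltW.
rewrite normrM (le_trans (ler_piMl _ (tn l)))// (le_trans (ler_norm_sum _ _ _))//.
by apply: ler_sum => i _; rewrite normrM ler_piMr.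
Qed.

(** Used twice: with [l] = 0 and powers of x as coefficients it gives the partial sums of the moment
    series, and with the moments of another measure as coefficients the partial sums of row [l] of a
    linear system. *)
Lemma sum_moment (l n : nat) (c : nat -> R) :
  \sum_(0 <= i < n) moment b mu (l + i) * c i =
  sgn R b * \int[mu]_(t in I) (t ^+ l * \sum_(0 <= i < n) c i * t ^+ i).
Proof.
elim: n => [|n IHn].
  rewrite big_nil; under eq_Rintegral do rewrite big_nil mulr0.
  by rewrite Rintegral_cst ?mul0r ?mulr0//; exact: measurable_I.
rewrite big_nat_recr//= IHn moment_I.
under [in RHS]eq_Rintegral => t _ do rewrite big_nat_recr//= mulrDr mulrCA -exprD.
rewrite RintegralD; first last.
- have := integrableZl measurable_I (c n) (pow_integrable (l + n)).
  by apply: eq_integrable.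
- exact: poly_sum_integrable.
- exact: measurable_I.
rewrite RintegralZl; [|exact: measurable_I|exact: pow_integrable].
by ring.
Qed.

Lemma mu_I_fin_num : mu I \is a fin_num.
Proof.
have := integrable_fin_num measurable_I (pow_integrable 0).
by rewrite (eq_integral (cst 1%E))// integral_cst ?mul1e.
Qed.

(** Bound on the remainder after n terms of the geometric expansion, the same for all x in [-1,1];
    at n = 0 it bounds the transform itself. *)
Definition cauchy_tail n := \int[mu]_(t in I) (t ^+ n * (1 - t)^-1).

Lemma measurable_tail n : measurable_fun I (fun t => t ^+ n * (1 - t)^-1).
Proof. by apply: measurable_funM; [exact: measurable_pow|exact: measurable_cauchy_kernel1]. Qed.

Lemma tail_integrable n :
  mu.-integrable I (EFin \o (fun t => t ^+ n * (1 - t)^-1)).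
Proof.
apply: (@cauchy_dominated_integrable 1); first exact: measurable_tail.
move=> t t01; have := cauchy_kernel1_ge1 t01; case/andP: t01 => t0 t1 k1.
rewrite normrM (ger0_norm (le_trans _ k1))// ler_wpM2r ?(le_trans _ k1)//.
by rewrite normrX exprn_ile1// ger0_norm// ltW.
Qed.

Lemma geometric_kernel_sub t x n : 0 <= t < 1 -> -1 <= x <= 1 ->
  (1 - t * x)^-1 - \sum_(0 <= i < n) x ^+ i * t ^+ i = (t * x) ^+ n * (1 - t * x)^-1.
Proof.
move=> t01 x01; have d0 : 1 - t * x != 0 by rewrite gt_eqF// cauchy_kernel_denom_gt0.
elim: n => [|n IHn]; first by rewrite big_nil subr0 expr0 mul1r.
rewrite big_nat_recr//= opprD addrA IHn exprS exprMn.
by field.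
Qed.

(** The difference is, up to sign, the integral of (t x)^n / (1 - t x), and on [-1,1] both |t x| <=
    t and 1 - t x >= 1 - t hold. *)
Lemma moment_series_sub_le x n : -1 <= x <= 1 ->
  `|\sum_(0 <= i < n) moment b mu i * x ^+ i - tilde b mu x| <= cauchy_tail n.
Proof.
move=> x01; rewrite (sum_moment 0 n) tilde_I// -mulrBr.
rewrite normrM normr_sgn mul1r distrC.
rewrite -RintegralB; [|exact: measurable_I|exact: kernel_integrable|exact: poly_sum_integrable].
rewrite (@eq_Rintegral _ _ _ _ _ (fun t => (t * x) ^+ n * (1 - t * x)^-1)); last first.
  by move=> t /set_mem /in_I t01; rewrite expr0 mul1r geometric_kernel_sub.
have tailP t : 0 <= t < 1 ->
    `|(t * x) ^+ n * (1 - t * x)^-1| <= t ^+ n * (1 - t)^-1.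
  move=> t01; have d0 := cauchy_kernel_denom_gt0 t01 x01; have t0 := t01.
  rewrite normrM normrX ler_pM ?exprn_ge0//.
    rewrite lerXn2r ?nnegrE//; first by case/andP: t0.
    by rewrite normrM ger0_norm ?ler_piMr ?ler_norml//; case/andP: t0.
  by rewrite ger0_norm ?cauchy_kernel_le// invr_ge0 ltW.
have intf : mu.-integrable I (EFin \o (fun t => (t * x) ^+ n * (1 - t * x)^-1)).
  apply: (@cauchy_dominated_integrable 1).
    apply: measurable_funM; last exact: measurable_cauchy_kernel.
    by apply: measurable_funX; apply: measurable_funM => //; exact: measurable_id.
  move=> t t01; rewrite (le_trans (tailP _ t01))// ler_wpM2r//.
    by rewrite (le_trans _ (cauchy_kernel1_ge1 t01)).
  by case/andP: t01 => t0 t1; rewrite exprn_ile1// ltW.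
rewrite (le_trans (le_normr_Rintegral measurable_I intf))//.
apply: le_Rintegral; [exact: measurable_I| |exact: tail_integrable|].
  exact: integrable_norm.
by move=> t /in_I /tailP.
Qed.

(** Dominated convergence with dominating function 1 / (1 - t): on [0,1[ the factor t^n tends to
    0. *)
Lemma cauchy_tail_cvg : cauchy_tail n @[n --> \oo] --> 0.
Proof.
have mE n : measurable_fun I (fun t => (t ^+ n * (1 - t)^-1)%:E).
  by apply/measurable_EFinP; exact: measurable_tail.
have [||_ _] := @dominated_convergence _ _ _ mu _ measurable_I
  _ (cst 0%E) _ mE (measurable_cst _) _ cmu.2 _; last first.
  by rewrite integral0 => /fine_cvg.
- apply: aeW => t n /in_I t01; rewrite abse_EFin lee_fin.
  have k1 := cauchy_kernel1_ge1 t01; case/andP: t01 => t0 t1.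
  have k0 := le_trans ler01 k1.
  by rewrite normrM normrX !ger0_norm// ler_piMl// exprn_ile1// ltW.
- apply: aeW => t /in_I /andP[t0 t1]; apply: cvg_EFin; first exact: nearW.
  rewrite -[X in _ --> X](mul0r (1 - t)^-1); apply: cvgM; last exact: cvg_cst.
  by apply: cvg_expr; rewrite ger0_norm.
Qed.

Lemma tilde_normr_le x : -1 <= x <= 1 -> `|tilde b mu x| <= cauchy_tail 0.
Proof. by move=> /(moment_series_sub_le 0); rewrite big_nil sub0r normrN. Qed.

Lemma moment_series_cvg x : -1 <= x <= 1 ->
  \sum_(0 <= i < n) moment b mu i * x ^+ i @[n --> \oo] --> tilde b mu x.
Proof.
move=> x01; apply: (cvg_of_norm_sub_le _ cauchy_tail_cvg) => n.
exact: moment_series_sub_le.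
Qed.

Lemma moment_series_unif_cvg :
  unif_cvg_on `[-1, 1] (fun n x => \sum_(0 <= i < n) moment b mu i * x ^+ i) (tilde b mu).
Proof.
move=> e e0; have /cvgr0_norm_lt /(_ _ e0) [N _ tN] := cauchy_tail_cvg.
exists N => n Nn x; rewrite /= in_itv/= => x01.
apply: le_lt_trans (moment_series_sub_le n x01) _.
exact: le_lt_trans (ler_norm _) (tN _ Nn).
Qed.

(** On [0,1[ the transform is a pointwise limit of polynomials, the partial sums of its moment
    series. *)
Lemma measurable_tilde : measurable_fun I (tilde b mu).
Proof.
apply: (@measurable_fun_cvg _ _ _ _
  (fun n t => \sum_(0 <= i < n) moment b mu i * t ^+ i)) => [n|t /in_I t01].
  apply: measurable_sum => i; apply: measurable_funM => //; exact: measurable_pow.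
by apply: moment_series_cvg; case/andP: t01 => t0 t1; apply/andP; split; lra.
Qed.

(** The kernel is at least 1 when t and x are nonnegative. This lower bound later keeps the support
    of a bracket infinite. *)
Lemma tilde_sgn_ge x : 0 <= x <= 1 -> fine (mu I) <= sgn R b * tilde b mu x.
Proof.
move=> /andP[x0 x1]; have x01 : -1 <= x <= 1 by apply/andP; split; lra.
rewrite tilde_I// mulrA sgn_mulss mul1r -[leLHS]mul1r -Rintegral_cst//.
apply: le_Rintegral => //.
- exact: eq_integrable (pow_integrable 0).
- exact: kernel_integrable.
- move=> t /in_I t01; have := cauchy_kernel_denom_gt0 t01 x01 => d0.
  by rewrite invf_ge1// gerBl mulr_ge0//; case/andP: t01.
Qed.

End one_measure.

(** The partial sum is the integral of t^l times a partial moment series of [nu] at t. That series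
    approaches [tilde b' nu] uniformly with error [cauchy_tail nu n], and [mu] has finite mass. *)
Lemma moment_bracket_series b mu b' nu l : cauchy_integrable mu -> cauchy_integrable nu ->
  \sum_(0 <= i < n) moment b mu (l + i) * moment b' nu i @[n --> \oo] -->
  sint b mu (fun t => tilde b' nu t * t ^+ l).
Proof.
move=> cmu cnu.
have mf : measurable_fun I (fun t => tilde b' nu t * t ^+ l).
  by apply: measurable_funM; [exact: measurable_tilde|exact: measurable_pow].
have I01 t : 0 <= t < 1 -> -1 <= t <= 1.
  by move=> /andP[t0 t1]; apply/andP; split; lra.
have pow1 t k : 0 <= t < 1 -> `|t ^+ k| <= 1.
  by move=> /andP[t0 t1]; rewrite normrX exprn_ile1// ger0_norm// ltW.
have intf : mu.-integrable I (EFin \o (fun t => tilde b' nu t * t ^+ l)).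
  apply: (bounded_integrable cmu (C := cauchy_tail nu 0)) => // t t01.
  rewrite normrM (le_trans (ler_piMr _ (pow1 _ _ t01)))//.
  exact/(tilde_normr_le _ cnu)/I01.
have tail0 : cauchy_tail nu n * fine (mu I) @[n --> \oo] --> 0.
  rewrite -[X in _ --> X](mul0r (fine (mu I))).
  by apply: cvgM; [exact: cauchy_tail_cvg|exact: cvg_cst].
apply: (cvg_of_norm_sub_le _ tail0) => n /=.
rewrite (sum_moment _ cmu) sint_I; [|exact: cmu.1|exact: mf].
rewrite -mulrBr normrM normr_sgn mul1r -RintegralB; [|exact: measurable_I|exact: poly_sum_integrable|exact: intf].
have intD := integrableB measurable_I (poly_sum_integrable cmu l n (moment b' nu)) intf.
rewrite (le_trans (le_normr_Rintegral measurable_I intD))//.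
rewrite -Rintegral_cst; last exact: measurable_I.
apply: le_Rintegral; [exact: measurable_I|exact: integrable_norm| |].
  apply: (bounded_integrable cmu (C := `|cauchy_tail nu n|)) => //.
move=> t /in_I t01.
rewrite -[X in X - _]mulrC -mulrBl normrM (le_trans (ler_piMr _ (pow1 _ _ t01)))//.
exact/(moment_series_sub_le _ cnu)/I01.
Qed.

(** * Membership in M_0 as integrability of 1 / (1 - t) *)

Section in_M0.
Variables (b : bool) (mu : {measure set R -> \bar R}).

Lemma tilde_I_normr x : mu [set 1] = 0%E -> -1 <= x <= 1 ->
  `|tilde b mu x| = \int[mu]_(t in I) (1 - t * x)^-1.
Proof.
move=> mu1 x01; rewrite /tilde sint_I//; last exact: measurable_cauchy_kernel.
rewrite normrM normr_sgn mul1r ger0_norm//; apply: Rintegral_ge0 => t /in_I t01.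
by rewrite invr_ge0 ltW// cauchy_kernel_denom_gt0.
Qed.

Lemma finite_kernel_integrable x : (mu setT < +oo)%E -> 0 <= x < 1 ->
  mu.-integrable (`[0, 1]%classic : set R) (EFin \o (fun t => (1 - t * x)^-1)).
Proof.
move=> mufin /andP[x0 x1]; apply: measurable_bounded_integrable => //.
- by rewrite (le_lt_trans _ mufin)// le_measure// inE.
- apply: measurable_fun_itv01; apply: measurable_cauchy_kernel.
  by apply/andP; split; lra.
- exists (1 - x)^-1; split; first exact: num_real.
  move=> M xM t /=; rewrite in_itv/= => /andP[t0 t1].
  have d1 : 0 < 1 - x by lra.
  have d0 : 1 - x <= 1 - t * x by nra.
  rewrite (le_trans _ (ltW xM))// ger0_norm ?invr_ge0; last by lra.
  by rewrite lef_pV2// posrE; lra.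
Qed.

(** Along a sequence increasing to 1, boundedness of the transform first excludes an atom at 1;
    monotone convergence then identifies the integral of 1 / (1 - t) with the finite limit [L]. *)
Lemma in_M0_cauchy_integrable : in_M0 b mu -> cauchy_integrable mu.
Proof.
move=> [[mufin _ _] [L /cvg_at_leftP cvgL]].
(* At t = 1 the kernel at [x n] equals n + 1, so the mass at 1 is at most the absolute value of the
   transform at [x n] divided by n + 1. *)
pose x n : R := 1 - n.+1%:R^-1.
have xlt n : x n < 1 by rewrite /x ltrBlDr ltrDl invr_gt0.
have x0 n : 0 <= x n by rewrite subr_ge0 invf_le1 ?ler1n// ltr0Sn.
have x01 n : -1 <= x n <= 1 by have := xlt n; have := x0 n; move=> ? ?; apply/andP; split; lra.
have xcvg : x n @[n --> \oo] --> (1 : R).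
  rewrite -[X in _ --> X]subr0; apply: cvgB; first exact: cvg_cst.
  exact: cvg_harmonic.
have {}cvgL := cvgL _ (conj xlt xcvg).
have mu1fin : mu [set 1] \is a fin_num.
  by rewrite ge0_fin_numE// (le_lt_trans _ mufin)// le_measure// inE.
have mu1 : mu [set 1] = 0%E.
  rewrite -(fineK mu1fin); congr EFin; apply/eqP; rewrite eq_le fine_ge0// andbT.
  have cvg0 : `|tilde b mu (x n)| * n.+1%:R^-1 @[n --> \oo] --> (0 : R).
    rewrite -[X in _ --> X](mulr0 L).
    by apply: cvgM => //; exact: cvg_harmonic.
  apply: (ler_cvg_to (cvg_cst (fine (mu [set 1]))) cvg0); apply: nearW => n.
  rewrite /= ler_pdivlMr// /tilde /sint normrM.
  have kge0 t : `[0, 1]%classic t -> 0 <= (1 - t * x n)^-1.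
    by move=> /=; rewrite in_itv/= => /andP[t0 t1]; rewrite invr_ge0; have := xlt n; have := x0 n; nra.
  rewrite normr_sgn mul1r ger0_norm; last exact: Rintegral_ge0.
  have int := finite_kernel_integrable mufin (introT andP (conj (x0 n) (xlt n))).
  rewrite -lee_fin fineK; last exact: integrable_fin_num.
  rewrite EFinM fineK//.
  have -> : (mu [set 1%R] * (n.+1%:R)%:E = \int[mu]_(t in [set (1 : R)%R]) ((1 - t * x n)^-1)%:E)%E.
    rewrite (eq_integral (cst (n.+1%:R)%:E)); first by rewrite integral_cst// muleC.
    by move=> t /set_mem /= ->; rewrite mul1r /x opprB addrC subrK invrK.
  apply: ge0_subset_integral => //.
  - exact: measurable_int int.
  - by move=> t /= ->; rewrite in_itv/= ler01 lexx.
split=> //; apply/integrableP; split.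
  by apply/measurable_EFinP; exact: measurable_cauchy_kernel1.
have mk n : measurable_fun I (fun t => ((1 - t * x n)^-1)%:E).
  by apply/measurable_EFinP; exact: measurable_cauchy_kernel.
have k0 n t : I t -> (0 <= ((1 - t * x n)^-1)%:E)%E.
  by move=> /in_I t01; rewrite lee_fin invr_ge0 ltW// cauchy_kernel_denom_gt0.
have knd t : I t -> {homo (fun n => ((1 - t * x n)^-1)%:E) : n m / (n <= m)%N >-> (n <= m)%E}.
  move=> /in_I t01 n m nm; rewrite lee_fin cauchy_kernel_le_nondecreasing//.
  by rewrite lerD2l lerN2 lef_pV2 ?posrE// ler_nat.
have mono := cvg_monotone_convergence measurable_I mk k0 knd.
rewrite (eq_integral (fun t => limn (fun n => ((1 - t * x n)^-1)%:E))); last first.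
  move=> t /set_mem /in_I t01; apply/esym/cvg_lim => //.
  rewrite abse_EFin ger0_norm; last by rewrite (le_trans _ (cauchy_kernel1_ge1 t01)).
  apply: cvg_EFin; first exact: nearW.
  have -> : (1 - t)^-1 = (1 - t * 1)^-1 by rewrite mulr1.
  apply: cvgV; first by rewrite gt_eqF// mulr1 subr_gt0; case/andP: t01.
  by apply: cvgB; [exact: cvg_cst|apply: cvgM => //; exact: cvg_cst].
have cvgE : (\int[mu]_(t in I) ((1 - t * x n)^-1)%:E)%E @[n --> \oo] --> L%:E.
  have -> : (fun n => \int[mu]_(t in I) ((1 - t * x n)^-1)%:E)%E =
            (fun n => (`|tilde b mu (x n)|)%:E).
    apply/funext => n; rewrite tilde_I_normr// fineK//.
    apply: integrable_fin_num => //.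
    apply: integrableS (finite_kernel_integrable mufin (introT andP (conj (x0 n) (xlt n)))) => //.
    by rewrite -setU_I1; exact: subsetUl.
  by apply: cvg_EFin => //; exact: nearW.
by rewrite (cvg_unique _ (mono mu) cvgE)// ltry.
Qed.

(** Near 1 the absolute value of the transform is nondecreasing in x, as the kernel is, and bounded
    by [cauchy_tail mu 0]; hence its left limit exists. *)
Lemma cauchy_integrable_in_M0 : in_M mu -> cauchy_integrable mu -> in_M0 b mu.
Proof.
move=> Mmu cmu; split=> //.
suff /cvg_ex : cvg ((fun x => `|tilde b mu x|) x @[x --> 1^'-]) by [].
have i11 (x y : R) : 0 <= x -> y \in `]x, 1[ -> -1 <= y <= 1.
  by rewrite in_itv/= => x0 /andP[xy y1]; apply/andP; split; lra.
apply: nondecreasing_at_left_is_cvgr; near=> x.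
  have x0 : 0 <= x by near: x; exact: nbhs_left_ge.
  move=> y z yx zx yz; have y1 := i11 _ _ x0 yx; have z1 := i11 _ _ x0 zx.
  rewrite !tilde_I_normr//; [|exact: cmu.1..].
  apply: le_Rintegral; [exact: measurable_I|exact: kernel_integrable..|].
  by move=> t /in_I t01; exact: cauchy_kernel_le_nondecreasing.
have x0 : 0 <= x by near: x; exact: nbhs_left_ge.
exists (cauchy_tail mu 0) => _ [y /= yx <-].
by apply: tilde_normr_le => //; exact: (i11 x).
Unshelve. all: by end_near. Qed.

End in_M0.

(** * The bracket of two measures in M_0 *)

Lemma measure_setI_I mu (A : set R) : in_M mu -> mu [set 1] = 0%E -> measurable A ->
  mu (A `&` I) = mu A.
Proof.
move=> [_ muJ _] mu1 mA.
have nI : mu (~` I) = 0%E.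
  have -> : ~` I = ~` (`[0, 1]%classic : set R) `|` [set 1].
    by rewrite -setDitv01 setCD.
  by rewrite null_set_setU//; apply: measurableC.
rewrite [RHS](measureDI mu mA measurable_I) [X in (X + _)%E](_ : _ = 0%E) ?add0e//.
apply: (subset_measure0 _ _ _ nI).
- exact: measurableD.
- exact: measurableC.
- by move=> t [].
Qed.

(** If [0,1[ were null, every ball would be null and the support empty, hence finite. *)
Lemma mu_I_gt0 mu : in_M mu -> cauchy_integrable mu -> 0 < fine (mu I).
Proof.
move=> Mmu cmu; rewrite fine_gt0//.
apply/andP; split; last by rewrite -ge0_fin_numE// mu_I_fin_num.
rewrite lt0e measure_ge0 andbT; apply/eqP => mI0.
case: (Mmu) => _ _; apply.
suff -> : supp mu = set0 by exact: finite_set0.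
apply/seteqP; split => // x /(_ 1 ltr01).
rewrite -measure_setI_I; [|exact: Mmu|exact: cmu.1|exact: measurable_ball].
rewrite ltNge => /negP; apply.
rewrite -mI0 le_measure ?inE//; first by apply: measurableI => //; exact: measurable_ball.
Qed.

(** The bracket is the measure with density [sgn R b' * tilde b' nu] on [0,1[ relative to [mu], a
    positive density, with the product of the two signs in front. The bound on [f] admits both the
    powers and the Cauchy kernels. *)
Lemma bracket_exists b mu b' nu : in_M0 b mu -> in_M0 b' nu ->
  exists b'' rho, in_M0 b'' rho /\
    forall f : R -> R, measurable_fun I f ->
      (forall t, 0 <= t < 1 -> 0 <= f t <= (1 - t)^-1) ->
      sint b'' rho f = sint b mu (fun t => tilde b' nu t * f t).
Proof.
move=> M0mu M0nu; have cmu := in_M0_cauchy_integrable M0mu.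
have cnu := in_M0_cauchy_integrable M0nu.
have [Mmu _] := M0mu; have [Mnu _] := M0nu.
pose c := fine (nu I); have c0 : 0 < c by exact: mu_I_gt0.
pose C := cauchy_tail nu 0.
pose g t := sgn R b' * tilde b' nu t.
have cg t : 0 <= t < 1 -> c <= g t.
  by move=> /andP[t0 t1]; apply: tilde_sgn_ge => //; rewrite t0 ltW.
have gC t : 0 <= t < 1 -> `|g t| <= C.
  move=> /andP[t0 t1]; rewrite normrM normr_sgn mul1r; apply: tilde_normr_le => //.
  by apply/andP; split; lra.
have C0 : 0 <= C by apply: le_trans (gC 0 _); rewrite ?lexx ?ltr01.
(* Extension by 0 makes the density nonnegative and measurable on the whole line, and leaves no mass
   outside [0,1[, in particular none at 1. *)
pose h := g \_ I.
have mg : measurable_fun I g by apply: measurable_funM => //; exact: measurable_tilde.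
have mh : measurable_fun setT h by apply/(measurable_restrictT g).
have hI t : 0 <= t < 1 -> h t = g t by move=> t01; rewrite /h patchT// inE/= in_itv.
have hN t : ~ I t -> h t = 0 by move=> It; rewrite /h patchN// notin_setE.
have h0 t : 0 <= h t.
  have [It|/hN->//] := pselect (I t).
  by rewrite hI ?in_I// (le_trans (ltW c0))// cg// in_I.
have hC t : h t <= C.
  have [/in_I t01|/hN->//] := pselect (I t).
  by rewrite hI// (le_trans (ler_norm _))// gC.
pose rho : {measure set R -> \bar R} := density mu mh h0.
have rhoN (A : set R) : A `<=` ~` I -> rho A = 0%E.
  by move=> AI; apply: integral0_eq => t /AI /hN ->.
have rho1 : rho [set 1] = 0%E.
  by apply: rhoN => t /= ->; rewrite in_itv/= ltxx andbF.
have Mrho : in_M rho.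
  split.
  - have [mufin _ _] := Mmu.
    apply: (@le_lt_trans _ _ (\int[mu]_t C%:E)%E).
      apply: ge0_le_integral => //; first by move=> t _; rewrite lee_fin.
      - exact/measurable_EFinP.
      - by move=> t _; rewrite lee_fin.
    by rewrite integral_cst// lte_mul_pinfty// lee_fin.
  - apply: rhoN => t /= + tI; apply; move: tI; rewrite !in_itv/=.
    by move=> /andP[-> /ltW].
  (* Since [h] is at least [c] on [0,1[, balls of positive [mu] measure have positive [rho] measure,
     so the support of [mu] lies in that of [rho]. *)
  - case: (Mmu) => _ _; apply: contra_not; apply: sub_finite_set => x sx e e0.
    have mb : measurable (ball x e `&` I) by apply: measurableI => //; exact: measurable_ball.
    apply: (@lt_le_trans _ _ (\int[mu]_(t in ball x e `&` I) c%:E)%E).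
      rewrite integral_cst// mule_gt0 ?lte_fin// measure_setI_I ?sx//; first exact: cmu.1.
      exact: measurable_ball.
    apply: (@le_trans _ _ (\int[mu]_(t in ball x e `&` I) (h t)%:E)%E).
      apply: ge0_le_integral => //.
      - by move=> t _; rewrite lee_fin ltW.
      - by apply/measurable_EFinP; exact: (measurable_funTS mh).
      - by move=> t [_ /in_I t01]; rewrite lee_fin hI// cg.
    apply: ge0_subset_integral => //; first exact: measurable_ball.
    - by apply/measurable_EFinP; exact: (measurable_funTS mh).
    - by move=> t _; rewrite lee_fin.
have k0 t : 0 <= t < 1 -> 0 <= (1 - t)^-1.
  by move=> t01; rewrite (le_trans _ (cauchy_kernel1_ge1 t01)).
have crho : cauchy_integrable rho.
  split=> //; apply/integrableP; split.
    by apply/measurable_EFinP; exact: measurable_cauchy_kernel1.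
  have /integrableP[_ fin] := integrableZl measurable_I C cmu.2.
  apply: le_lt_trans fin.
  rewrite ge0_integral_density//; last first.
    by apply: measurableT_comp => //; apply/measurable_EFinP; exact: measurable_cauchy_kernel1.
  have mk : measurable_fun I (fun t => ((1 - t)^-1)%:E).
    by apply/measurable_EFinP; exact: measurable_cauchy_kernel1.
  apply: ge0_le_integral => //.
  - by move=> t _; rewrite mule_ge0 ?lee_fin.
  - apply: emeasurable_funM; first exact: measurableT_comp.
    by apply/measurable_EFinP; exact: (measurable_funTS mh).
  - apply: measurableT_comp => //; exact: measurable_funeM.
  - move=> t /in_I t01; rewrite -EFinM !abse_EFin lee_fin normrM mulrC.
    by rewrite ler_wpM2r// ger0_norm.
(* With [true] standing for the sign +1, equality of booleans is the product of signs. *)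
exists (b == b'), rho; split; first exact: cauchy_integrable_in_M0.
move=> f mf f0.
have mtf : measurable_fun I (fun t => tilde b' nu t * f t).
  by apply: measurable_funM => //; exact: measurable_tilde.
rewrite sint_I// sint_I//; last exact: cmu.1.
have -> : sgn R (b == b') = sgn R b * sgn R b'.
  by case: (b); case: (b'); rewrite /= ?mulrNN ?mulr1 ?mul1r.
have int : mu.-integrable I (EFin \o (fun t => tilde b' nu t * f t)).
  apply: (cauchy_dominated_integrable cmu (C := C)) => // t t01.
  have /andP[ft0 ftk] := f0 _ t01.
  rewrite normrM ler_pM// ?(ger0_norm ft0)//.
  by have := gC _ t01; rewrite normrM normr_sgn mul1r.
have -> : \int[rho]_(t in I) f t = sgn R b' * \int[mu]_(t in I) (tilde b' nu t * f t).
  rewrite -RintegralZl//; congr fine.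
  rewrite ge0_integral_density//; [|by apply/measurable_EFinP|].
    by apply: eq_integral => t /set_mem /in_I t01; rewrite -EFinM hI// /g mulrC mulrA.
  by move=> t /in_I /f0/andP[]; rewrite lee_fin.
by rewrite mulrA -(mulrA (sgn R b)) sgn_mulss mulr1.
Qed.

(** * Iterated brackets *)

Lemma eq_sint b mu (f g : R -> R) : (forall t, 0 <= t <= 1 -> f t = g t) ->
  sint b mu f = sint b mu g.
Proof.
move=> fg; congr (_ * _); apply: eq_Rintegral => t.
by rewrite inE/= in_itv => /fg.
Qed.

(* l-th moment of [sigma_m, ..., sigma_(m+n)] *)
Definition nik_moment (b : nat -> bool) (mu : nat -> {measure set R -> \bar R})
    (n m l : nat) : R :=
  sint (b m) (mu m)
    (fun t => (if n is n'.+1 then nik b mu n' m.+1 t else 1) * t ^+ l).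

Section nik.
Variables (b : nat -> bool) (mu : nat -> {measure set R -> \bar R}).

Lemma nik_moment0 m l : nik_moment b mu 0 m l = moment (b m) (mu m) l.
Proof. by apply: eq_sint => t _; rewrite mul1r. Qed.

(** Induction on [n], bracketing [mu m] with the measure that represents the shorter chain. One
    measure serves both the transform and the moments, so the results on single measures apply to
    iterated brackets. *)
Lemma nik_represented n m :
  (forall j, (m <= j <= m + n)%N -> in_M0 (b j) (mu j)) ->
  exists c nu, [/\ in_M0 c nu,
    forall x, -1 <= x <= 1 -> nik b mu n m x = tilde c nu x &
    forall l, nik_moment b mu n m l = moment c nu l].
Proof.
elim: n m => [|n IHn] m M0.
  exists (b m), (mu m); split => //; last exact: nik_moment0.
  by apply: M0; lia.
have M0m : in_M0 (b m) (mu m) by apply: M0; lia.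
have [|c [nu [M0nu nikE _]]] := IHn m.+1; first by move=> j mj; apply: M0; lia.
have [c' [rho [M0rho rhoE]]] := bracket_exists M0m M0nu.
have nikE01 t : 0 <= t <= 1 -> nik b mu n m.+1 t = tilde c nu t.
  by move=> /andP[t0 t1]; apply: nikE; apply/andP; split; lra.
exists c', rho; split => // [x x01|l].
  rewrite /= /tilde rhoE.
  - by apply: eq_sint => t /nikE01 ->.
  - exact: measurable_cauchy_kernel.
  - move=> t t01; rewrite cauchy_kernel_le// andbT invr_ge0 ltW//.
    exact: cauchy_kernel_denom_gt0.
rewrite /moment rhoE.
- by apply: eq_sint => t /nikE01 ->.
- exact: measurable_pow.
- move=> t t01; have /andP[t0 t1] := t01.
  by rewrite exprn_ge0//= (le_trans _ (cauchy_kernel1_ge1 t01))// exprn_ile1// ltW.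
Qed.

(** This is row [l] of the linear system that links level [m] to level [m.+1]. *)
Lemma nik_moment_series n m l :
  (forall j, (m <= j <= m + n.+1)%N -> in_M0 (b j) (mu j)) ->
  \sum_(0 <= i < k) moment (b m) (mu m) (l + i) * nik_moment b mu n m.+1 i
    @[k --> \oo] --> nik_moment b mu n.+1 m l.
Proof.
move=> M0; have M0m : in_M0 (b m) (mu m) by apply: M0; lia.
have [|c [nu [M0nu nikE momE]]] := @nik_represented n m.+1.
  by move=> j mj; apply: M0; lia.
have -> : nik_moment b mu n.+1 m l = sint (b m) (mu m) (fun t => tilde c nu t * t ^+ l).
  apply: eq_sint => t /andP[t0 t1]; rewrite nikE//.
  by apply/andP; split; lra.
under eq_fun do under eq_bigr do rewrite momE.
apply: moment_bracket_series.
  exact: in_M0_cauchy_integrable M0m.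
exact: in_M0_cauchy_integrable M0nu.
Qed.

Lemma nik_unif_cvg n m :
  (forall j, (m <= j <= m + n)%N -> in_M0 (b j) (mu j)) ->
  unif_cvg_on `[-1, 1] (fun k x => \sum_(0 <= i < k) nik_moment b mu n m i * x ^+ i)
    (nik b mu n m).
Proof.
move=> /nik_represented[c [nu [M0nu nikE momE]]] e e0.
have [N cvgN] := moment_series_unif_cvg c (in_M0_cauchy_integrable M0nu) e0.
exists N => k Nk x x01; rewrite nikE; last by move: x01; rewrite /= in_itv.
under eq_bigr do rewrite momE.
exact: cvgN.
Qed.

End nik.

End cauchy_transform.

(** * From Nikishin systems to moment problems and back *)

(* a j i = lambda_{i,j,1}, the coefficients of w_j;  lam i j k = lambda_{i,j,k} *)
Theorem theorem2p1 (R : realType) (p : nat) (a : nat -> nat -> R) :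
  (exists (b : nat -> bool) (mu : nat -> {measure set R -> \bar R}),
      (forall j, (1 <= j <= p)%N -> in_M0 (b j) (mu j)) /\
      (forall j, (1 <= j <= p)%N ->
         unif_cvg_on `[-1, 1] (fun n x => \sum_(0 <= i < n) a j i * x ^+ i)
           (nikishin_fun b mu j)))
  <->
  (exists lam : nat -> nat -> nat -> R,
      (forall i j, lam i j 1%N = a j i) /\
      (forall k j, (1 <= k)%N -> (k < j <= p)%N -> forall l : nat,
         (fun n => \sum_(0 <= i < n) lam (l + i)%N k k * lam i j k.+1)
           @ \oo --> lam l j k) /\
      (forall k j, (1 <= k <= j)%N -> (j <= p)%N ->
         restricted_hausdorff_solvable (fun i => lam i j k))).
Proof.
split=> [[b [mu [M0 wcvg]]]|[lam [lam1 [lamcvg lamsolv]]]].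
  (* Level 1 must equal [a] for every j, also outside 1..p, hence the case split. Inside that range
     both branches agree at k = 1, since [a j] and the moments of the bracket are coefficients of
     the same function. *)
  pose lam i j k := if k == 1%N then a j i else nik_moment b mu (j - k) k i.
  have lamE i j k : (1 <= k <= j)%N -> (j <= p)%N ->
      lam i j k = nik_moment b mu (j - k) k i.
    rewrite /lam; case: eqVneq => // -> jle jp.
    apply: power_series_inj (wcvg j _) _ i; first lia.
    rewrite /nikishin_fun -subn1; apply: nik_unif_cvg => j' ?.
    by apply: M0; lia.
  exists lam; split; first by move=> i j; rewrite /lam eqxx.
  split=> [k j k1 kj l|k j kj jp].
    rewrite lamE; [|lia|lia].
    have -> : (j - k = (j - k.+1).+1)%N by lia.
    have -> : (fun n => \sum_(0 <= i < n) lam (l + i)%N k k * lam i j k.+1) =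
        (fun n => \sum_(0 <= i < n)
          moment (b k) (mu k) (l + i) * nik_moment b mu (j - k.+1) k.+1 i).
      apply/funext => n; apply: eq_bigr => i _.
      by rewrite (lamE _ k k) ?(lamE _ j k.+1) ?subnn ?nik_moment0//; lia.
    by apply: nik_moment_series => j' ?; apply: M0; lia.
  have [|c [nu [M0nu _ momE]]] := @nik_represented R b mu (j - k) k.
    by move=> j' ?; apply: M0; lia.
  by exists c, nu; split => // i; rewrite lamE// momE.
(* Only the diagonal problems supply the measures. Outside 1..p the zero measure is a filler that
   makes the choice function total. *)
have sol k : exists s : bool * {measure set R -> \bar R}, (1 <= k <= p)%N ->
    in_M0 s.1 s.2 /\ forall i, lam i k k = moment s.1 s.2 i.
  have [/andP[k1 kp]|_] := boolP (1 <= k <= p)%N; last by exists (true, [the {measure set R -> \bar R} of mzero]).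
  have [|c [nu cnu]] := lamsolv k k _ kp; first by rewrite k1 leqnn.
  by exists (c, nu).
have {sol}[s sP] := choice sol.
pose b k := (s k).1; pose mu k := (s k).2.
have M0 j : (1 <= j <= p)%N -> in_M0 (b j) (mu j) by move=> /sP[].
(* Induction on the distance [n] from the diagonal, for all k at once: the entries at level k + 1
   and distance n are the unknowns of the system at level k, whose right-hand side at distance n + 1
   is then fixed by uniqueness of limits. *)
have lamE n k l : (1 <= k)%N -> (k + n <= p)%N -> lam l (k + n)%N k = nik_moment b mu n k l.
  elim: n k l => [|n IHn] k l k1 kn.
    by rewrite nik_moment0 addn0; apply: (sP k _).2; lia.
  have kkn : (k < k + n.+1 <= p)%N by lia.
  have lamE0 : (fun n0 => \sum_(0 <= i < n0) lam (l + i)%N k k * lam i (k + n.+1)%N k.+1) =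
      (fun n0 => \sum_(0 <= i < n0)
        moment (b k) (mu k) (l + i) * nik_moment b mu n k.+1 i).
    apply/funext => n0; apply: eq_bigr => i _.
    by rewrite (sP k _).2 ?addnS -?addSn ?IHn//; lia.
  have lamk := lamcvg k (k + n.+1)%N k1 kkn l.
  rewrite lamE0 in lamk; apply: (cvg_unique _ lamk) => //.
  by apply: nik_moment_series => j' ?; apply: M0; lia.
exists b, mu; split=> // j j1p.
(* At level 1 the identity just proved says that [a j] lists the moments of the bracket of the first
   j measures. *)
have -> : (fun n x => \sum_(0 <= i < n) a j i * x ^+ i) =
    (fun n x => \sum_(0 <= i < n) nik_moment b mu j.-1 1 i * x ^+ i).
  apply/funext => n; apply/funext => x; apply: eq_bigr => i _.
  rewrite -lamE; [|lia|lia].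
  by rewrite lam1 (_ : (1 + j.-1)%N = j)//; lia.
by apply: nik_unif_cvg => j' ?; apply: M0; lia.
Qed.
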